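(* Let $R^i_t=\lambda^i(R)R^i_x$, $i=1,\dots,n$, be a semihamiltonian system, let $R^i_\tau=\mu^i(R)R^i_x$ be a commuting flow of it, and fix an index $\alpha\in\{1,\dots,n\}$. Consider the system $$R^i_T=\Lambda^i(R)R^i_X,\qquad i=1,\dots,n,$$ with the characteristic velocities $$\Lambda^\alpha=\frac{\lambda^\alpha\,\partial_\alpha\mu^\alpha-\mu^\alpha\,\partial_\alpha\lambda^\alpha}{\partial_\alpha\mu^\alpha},\qquad \Lambda^i=\frac{\lambda^i\mu^\alpha-\lambda^\alpha\mu^i}{\mu^\alpha-\mu^i}\quad (i\neq\alpha).$$ Then the conservation laws $U_T=F_X$ of this new system are the $\mathcal L^*_\alpha$-transforms of the conservation laws $u_t=f_x$ of the system $R^i_t=\lambda^iR^i_x$, that is, the pairs $(U,F)$ of the form $$U=\mathcal L^*_\alpha(u)=u-\frac{q}{\mu^\alpha},\qquad F=\mathcal L^*_\alpha(f)=f-\frac{\lambda^\alpha q}{\mu^\alpha},$$ where $q$ is a flux of the density $u$ corresponding to the commuting flow, i.e. $u_\tau=q_x$.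
   Context: All functions are smooth functions of $R=(R^1,\dots,R^n)$, considered locally on a small simply connected domain, and $\partial_i=\partial/\partial R^i$. There is no summation over repeated indices. The characteristic velocities $\lambda^i$ are real and pairwise distinct; put $a_{ij}=\frac{\partial_j\lambda^i}{\lambda^j-\lambda^i}$ for $i\neq j$. A conservation law $u_t=f_x$ of $R^i_t=\lambda^i(R)R^i_x$ is a pair of functions $u(R),f(R)$ with $\partial_if=\lambda^i\partial_iu$ for $i=1,\dots,n$; consequently $\partial_i\partial_ju=a_{ij}\partial_iu+a_{ji}\partial_ju$ for $i\neq j$. Conservation laws of the new system are defined in the same way with $\Lambda^i$ in place of $\lambda^i$. The system is called semihamiltonian if $\partial_ka_{ij}=a_{ik}a_{kj}+a_{ij}a_{jk}-a_{ij}a_{ik}$ for all pairwise distinct $i,j,k$. A commuting flow is a system $R^i_\tau=\mu^i(R)R^i_x$ whose characteristic velocities satisfy $\frac{\partial_j\mu^i}{\mu^j-\mu^i}=a_{ij}$ for all $i\neq j$. For a conserved density $u$ of the original system, a flux $q$ corresponding to the commuting flow ($u_\tau=q_x$) is a function $q(R)$ with $\partial_iq=\mu^i\partial_iu$ for $i=1,\dots,n$; it is defined up to an additive constant, and any choice of this constant is allowed. All expressions appearing in denominators ($\mu^\alpha$, $\partial_\alpha\mu^\alpha$, $\mu^j-\mu^i$ for $i\neq j$) are assumed to be nowhere zero on the domain, and the new characteristic velocities $\Lambda^1,\dots,\Lambda^n$ are assumed to be pairwise distinct. *)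

(* Defs.v *)
From HB Require Import structures.
From mathcomp Require Import all_boot all_order all_algebra.
From mathcomp Require Import all_classical all_reals all_analysis.

Set Implicit Arguments.
Unset Strict Implicit.
Unset Printing Implicit Defensive.

Import Order.TTheory GRing.Theory Num.Theory.
Import numFieldNormedType.Exports.

Local Open Scope classical_set_scope.
Local Open Scope ring_scope.

(* Functions on a domain D are total functions whose values matter only on D;
   since D is open, derivatives at points of D do not see the values outside. *)

Section Domains.
Context {R : realType} {n : nat}.
Implicit Types D : set 'rV[R]_n.

Definition path_in D (g : R -> 'rV[R]_n) : Prop :=
  {within `[0, 1], continuous g} /\ (forall t, 0 <= t <= 1 -> D (g t)).

Definition path_connected D : Prop :=
  forall x y, D x -> D y -> exists g, [/\ path_in D g, g 0 = x & g 1 = y].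

(* H (s, t) contracts the loop g inside D, relatively to its base point;
   t is the homotopy parameter. *)
Definition null_homotopic D (g : R -> 'rV[R]_n) : Prop :=
  exists H : R * R -> 'rV[R]_n,
    [/\ {within `[0, 1] `*` `[0, 1], continuous H},
        forall s t, 0 <= s <= 1 -> 0 <= t <= 1 -> D (H (s, t)),
        forall s, 0 <= s <= 1 -> H (s, 0) = g s /\ H (s, 1) = g 0 &
        forall t, 0 <= t <= 1 -> H (0, t) = g 0 /\ H (1, t) = g 0].

Definition simply_connected D : Prop :=
  path_connected D /\
  forall g, path_in D g -> g 0 = g 1 -> null_homotopic D g.

Definition simply_connected_domain D : Prop :=
  [/\ D !=set0, open D & simply_connected D].

End Domains.

Section Systems.
Context {R : realType} {n : nat}.
Implicit Types (D : set 'rV[R]_n) (u f q : 'rV[R]_n -> R).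
Implicit Types (i j k alpha : 'I_n).

Definition partial i f : 'rV[R]_n -> R :=
  fun x => 'D_(delta_mx 0 i) f x.

Definition iter_partial (s : seq 'I_n) f : 'rV[R]_n -> R :=
  foldr partial f s.

(* C^infinity: partial derivatives of all orders exist and are continuous. *)
Definition smooth_on D f : Prop :=
  forall (s : seq 'I_n) x, D x ->
    {for x, continuous (iter_partial s f)} /\
    (forall i, derivable (iter_partial s f) x (delta_mx 0 i)).

(* A diagonal system R^i_t = v^i(R) R^i_x is given by its velocities v. *)
Implicit Types v lam mu : 'I_n -> 'rV[R]_n -> R.

Definition smooth_velocities D v : Prop := forall i, smooth_on D (v i).

Definition distinct_velocities D v : Prop :=
  forall i j, i != j -> forall x, D x -> v i x != v j x.

Definition coef_a v i j : 'rV[R]_n -> R :=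
  fun x => partial j (v i) x / (v j x - v i x).

Definition semihamiltonian D v : Prop :=
  forall i j k, i != j -> j != k -> i != k -> forall x, D x ->
    partial k (coef_a v i j) x =
      coef_a v i k x * coef_a v k j x + coef_a v i j x * coef_a v j k x
      - coef_a v i j x * coef_a v i k x.

(* u_t = f_x *)
Definition conservation_law D v u f : Prop :=
  [/\ smooth_on D u, smooth_on D f &
      forall i x, D x -> partial i f x = v i x * partial i u x].

Definition commuting_flow D lam mu : Prop :=
  forall i j, i != j -> forall x, D x -> coef_a mu i j x = coef_a lam i j x.

(* u_tau = q_x; the additive constant in q is left free. *)
Definition flux_of D mu u q : Prop :=
  smooth_on D q /\
  forall i x, D x -> partial i q x = mu i x * partial i u x.

Definition new_velocity lam mu alpha i : 'rV[R]_n -> R := fun x =>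
  if i == alpha then
    (lam alpha x * partial alpha (mu alpha) x
     - mu alpha x * partial alpha (lam alpha) x) / partial alpha (mu alpha) x
  else
    (lam i x * mu alpha x - lam alpha x * mu i x) / (mu alpha x - mu i x).

(* The transforms of u and f depend on the flux q of u chosen for the
   commuting flow. *)
Definition Lstar_density mu alpha q u : 'rV[R]_n -> R :=
  fun x => u x - q x / mu alpha x.

Definition Lstar_flux lam mu alpha q f : 'rV[R]_n -> R :=
  fun x => f x - lam alpha x * q x / mu alpha x.

End Systems.

(* Main.v *)
Require Import Defs.
From HB Require Import structures.
From mathcomp Require Import all_boot all_order all_algebra.
From mathcomp Require Import all_classical all_reals all_analysis.
From mathcomp Require Import ring.

Import Order.TTheory GRing.Theory Num.Theory.
Import numFieldNormedType.Exports.

Local Open Scope classical_set_scope.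
Local Open Scope ring_scope.

(** Write [m] and [l] for [mu alpha] and [lam alpha], and
    [a i j = partial j (lam i) / (lam j - lam i)].  These coefficients are
    shared by [lam] and [mu], so [partial i m = a alpha i * (mu i - m)] and
    [partial i l = a alpha i * (lam i - l)] for [i != alpha].

    That transforms of conservation laws are conservation laws is a direct
    computation from these formulas ([conservation_law_Lstar]).

    Conversely, if [U = u - q / m] with [q] a flux of [u], then
    [partial alpha U = q * partial alpha m / m ^+ 2], so [q] is determined by
    [U]: [q = m ^+ 2 * W] with [W = partial alpha U / partial alpha m]
    ([recovered_flux]).  Hence [u = U + q / m] and [f = F + l * q / m] are
    explicit, no integration is needed, and it remains to check
    [partial i q = mu i * partial i u] and [partial i f = lam i * partial i u].
    Both are immediate for [i = alpha].  For [i != alpha], put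
    [V = partial i U / (m - mu i)]; the conservation law [(U, F)] then reads
      [partial alpha U = W * partial alpha m],
      [partial alpha F = W * (l * partial alpha m - m * partial alpha l)],
      [partial i U = (m - mu i) * V],
      [partial i F = (lam i * m - l * mu i) * V].
    Equality of the mixed derivatives of [U] and of [F] ([partial_comm]) gives
    two equations, linear in [W], [partial i W], [V] and [partial alpha V].
    Eliminating [partial alpha V] leaves an equation divisible by
    [(l - lam i) * partial alpha m - partial alpha l * (m - mu i)], a nonzero
    multiple of the difference of the new velocities of indices [alpha] and
    [i].  The quotient ([new_law_compatibility]) is the equation
    [partial i q = mu i * partial i u] in disguise, and the one for [f]
    follows from it.

    The analytic ingredients are the symmetry of mixed derivatives
    ([derive_comm]) and the stability of smooth functions under the field
    operations ([smooth_expr_on]). *)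

Set Implicit Arguments.
Unset Strict Implicit.

(** * Symmetry of mixed derivatives *)

Section MixedDerivatives.
Context {R : realType} {V : normedModType R}.
Implicit Types (f : V -> R) (x v w : V).

Lemma is_derive_line f x v t : derivable f (t *: v + x) v ->
  is_derive t 1 (fun s : R => f (s *: v + x)) ('D_v f (t *: v + x)).
Proof.
have E : (fun h : R => h^-1 *: (f ((h *: (1 : R) + t) *: v + x) - f (t *: v + x)))
       = (fun h : R => h^-1 *: (f (h *: v + (t *: v + x)) - f (t *: v + x))).
  by apply/funext => h; rewrite [h *: 1]mulr1 scalerDl addrA.
move=> df; apply: DeriveDef.
  by rewrite /derivable /= E.
by rewrite /derive /= E.
Qed.

Lemma MVT_line f x v (h : R) : 0 < h ->
  (forall t, 0 <= t <= h -> derivable f (t *: v + x) v) ->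
  exists2 c, 0 <= c <= h & f (h *: v + x) - f x = 'D_v f (c *: v + x) * h.
Proof.
move=> h0 df.
have dl (t : R) : t \in `[0, h] -> derivable (fun s : R => f (s *: v + x)) t 1.
  by rewrite in_itv/= => th; apply: ex_derive; apply: is_derive_line; exact: df.
have [||c cI] := @MVT R (fun s => f (s *: v + x))
  (fun t => 'D_v f (t *: v + x)) 0 h h0.
- move=> t /subset_itv_oo_cc; rewrite in_itv/= => th.
  by apply: is_derive_line; exact: df.
- by apply: derivable_within_continuous.
- rewrite scale0r add0r subr0 => ->; exists c => //.
  by move/subset_itv_oo_cc : cI; rewrite in_itv.
Qed.

(** The second difference of [f] over the parallelogram spanned by [h v] and
    [h w]; being symmetric in [v] and [w], it computes both mixed derivatives. *)
Lemma second_difference f x v w (h : R) : 0 < h ->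
  (forall s t, 0 <= s <= h -> 0 <= t <= h ->
    derivable f (s *: v + (t *: w + x)) v /\
    derivable ('D_v f) (s *: v + (t *: w + x)) w) ->
  exists s t, [/\ 0 <= s <= h, 0 <= t <= h &
    f (h *: v + (h *: w + x)) - f (h *: w + x) - f (h *: v + x) + f x
    = 'D_w ('D_v f) (s *: v + (t *: w + x)) * h ^+ 2].
Proof.
move=> h0 df.
have hh : 0 <= h <= h by rewrite lexx ltW.
have h00 : 0 <= (0 : R) <= h by rewrite lexx ltW.
pose phi s := f (s *: v + (h *: w + x)) - f (s *: v + x).
have dphi s : 0 <= s <= h -> is_derive s 1 phi
    ('D_v f (s *: v + (h *: w + x)) - 'D_v f (s *: v + x)).
  move=> sh; apply: is_deriveB; apply: is_derive_line.
    exact: (df _ _ sh hh).1.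
  by move: (df _ _ sh h00).1; rewrite scale0r add0r.
have [||s sI] := @MVT R phi
  (fun s => 'D_v f (s *: v + (h *: w + x)) - 'D_v f (s *: v + x)) 0 h h0.
- by move=> t /subset_itv_oo_cc; rewrite in_itv/=; exact: dphi.
- apply: derivable_within_continuous => t; rewrite in_itv/= => th.
  by apply: ex_derive; exact: dphi.
have {}sI : 0 <= s <= h by move/subset_itv_oo_cc : sI; rewrite in_itv.
rewrite subr0 /phi !scale0r !add0r => phiE.
have [t th|t tI dE] := @MVT_line ('D_v f) (s *: v + x) w h h0.
  by have [_] := df _ _ sI th; rewrite addrCA.
exists s, t; split => //.
rewrite expr2 mulrA (addrCA (s *: v)) -dE (addrCA (h *: w)) -phiE.
by ring.
Qed.

(** Symmetry of mixed derivatives (Schwarz). *)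
Lemma derive_comm f x v w (D : set V) : open D -> D x ->
  (forall y, D y -> derivable f y v /\ derivable f y w) ->
  (forall y, D y -> derivable ('D_v f) y w /\ derivable ('D_w f) y v) ->
  {for x, continuous ('D_w ('D_v f))} -> {for x, continuous ('D_v ('D_w f))} ->
  'D_w ('D_v f) x = 'D_v ('D_w f) x.
Proof.
move=> oD Dx df ddf cvw cwv; apply/eqP/contraT => AB.
set A := 'D_w _ x in AB *; set B := 'D_v _ x in AB *.
pose e := `|A - B| / 2.
have e0 : 0 < e by rewrite divr_gt0// normr_gt0 subr_eq0.
have near_x : \forall y \near x, [/\ D y, `|A - 'D_w ('D_v f) y| < e &
    `|B - 'D_v ('D_w f) y| < e].
  have n1 : \forall y \near x, D y by exact: open_nbhs_nbhs.
  have n2 : \forall y \near x, `|A - 'D_w ('D_v f) y| < e.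
    by move/cvgrPdist_lt : cvw => /(_ _ e0).
  have n3 : \forall y \near x, `|B - 'D_v ('D_w f) y| < e.
    by move/cvgrPdist_lt : cwv => /(_ _ e0).
  by apply: filterS3 n1 n2 n3.
have [d /= d0 dP] := (nbhs_ballP _ _).1 near_x.
pose h := d / (`|v| + `|w| + 1).
have N0 : 0 < `|v| + `|w| + 1 by rewrite ltr_wpDl// addr_ge0.
have h0 : 0 < h by rewrite divr_gt0.
(* The closed parallelogram lies in the ball of radius d around x. *)
have small s t : 0 <= s <= h -> 0 <= t <= h ->
    [/\ D (s *: v + (t *: w + x)),
      `|A - 'D_w ('D_v f) (s *: v + (t *: w + x))| < e &
      `|B - 'D_v ('D_w f) (s *: v + (t *: w + x))| < e].
  move=> /andP[s0 sh] /andP[t0 th]; apply: dP; rewrite -ball_normE /=.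
  rewrite addrA opprD addrCA subrr addr0 normrN.
  apply: (le_lt_trans (ler_normD _ _)); rewrite !normrZ !ger0_norm//.
  have : s * `|v| + t * `|w| <= h * (`|v| + `|w|).
    by rewrite mulrDr lerD// ler_wpM2r.
  move/le_lt_trans; apply.
  by rewrite -[ltRHS](divfK (lt0r_neq0 N0)) -/h ltr_pM2l// ltrDl.
have [s t sI tI|s [t [sI tI E1]]] := @second_difference f x v w h h0.
  have [Dy _ _] := small s t sI tI.
  by split; [exact: (df _ Dy).1|exact: (ddf _ Dy).1].
have [s' t' sI' tI'|s' [t' [sI' tI' E2]]] := @second_difference f x w v h h0.
  have [] := small t' s' tI' sI'; rewrite addrCA => Dy _ _.
  by split; [exact: (df _ Dy).2|exact: (ddf _ Dy).2].
have [_ H1 _] := small _ _ sI tI.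
have [_ _] := small _ _ tI' sI'; rewrite addrCA => H2.
have E : 'D_w ('D_v f) (s *: v + (t *: w + x))
       = 'D_v ('D_w f) (s' *: w + (t' *: v + x)).
  apply: (@mulIf _ (h ^+ 2)); first by rewrite expf_neq0// lt0r_neq0.
  apply: etrans (esym E1) (etrans _ E2).
  rewrite (addrCA (h *: v) (h *: w) x).
  by congr (_ + _); exact: addrAC.
rewrite -E in H2.
suff : `|A - B| < `|A - B| by rewrite ltxx.
rewrite [ltRHS]splitr -/e.
apply: le_lt_trans (ltrD H1 H2).
rewrite [X in _ <= _ + X]distrC; apply: le_trans (ler_normD _ _).
by rewrite addrA subrK.
Qed.

End MixedDerivatives.

(** * Smooth functions on an open set *)

Lemma near_eq_continuous {T U : topologicalType} {f g : T -> U} {x : T} :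
  {near x, f =1 g} -> {for x, continuous f} -> {for x, continuous g}.
Proof.
move=> fg cf; rewrite /prop_for /continuous_at -(nbhs_singleton fg).
by apply: cvg_trans cf; exact: near_eq_cvg.
Qed.

Section SmoothFunctions.
Context {R : realType} {n : nat}.
Implicit Types (D : set 'rV[R]_n) (f g : 'rV[R]_n -> R) (i j : 'I_n).

Lemma smooth_on_partial D f i : smooth_on D f -> smooth_on D (partial i f).
Proof.
move=> sf s x Dx; have := sf (rcons s i) x Dx.
by rewrite /iter_partial foldr_rcons.
Qed.

Lemma smooth_on_is_derive D f i x : smooth_on D f -> D x ->
  is_derive x (delta_mx 0 i) f (partial i f x).
Proof.
by move=> sf Dx; apply: DeriveDef => //; have [_] := sf [::] x Dx; exact.
Qed.

Lemma partial_comm D f i j x : open D -> smooth_on D f -> D x ->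
  partial i (partial j f) x = partial j (partial i f) x.
Proof.
move=> oD sf Dx; apply: (@derive_comm _ _ _ _ _ _ D) => // [y Dy|y Dy||].
- by split; apply: (sf [::] y Dy).2.
- by split; [apply: (sf [:: j] y Dy).2|apply: (sf [:: i] y Dy).2].
- exact: (sf [:: i; j] x Dx).1.
- exact: (sf [:: j; i] x Dx).1.
Qed.

Lemma eq_on_partial D f g i x : open D -> (forall y, D y -> f y = g y) ->
  D x -> partial i f x = partial i g x.
Proof.
move=> oD fg Dx; apply: near_eq_derive.
by apply: filterS (open_nbhs_nbhs (conj oD Dx)) => y; exact: fg.
Qed.

(** The functions obtained from smooth functions on [D] by finitely many ring
    operations and inversions of functions without zeros on [D], up to equality
    on [D].  This class is closed under partial derivatives
    ([smooth_expr_partial]) and consists of continuous functions with partial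
    derivatives ([smooth_expr_regular]), so its members are smooth; no Leibniz
    formula for iterated derivatives is needed. *)
Inductive smooth_expr D : ('rV[R]_n -> R) -> Prop :=
| Smooth_base f of smooth_on D f : smooth_expr D f
| Smooth_opp f of smooth_expr D f : smooth_expr D (fun x => - f x)
| Smooth_add f g of smooth_expr D f & smooth_expr D g :
    smooth_expr D (fun x => f x + g x)
| Smooth_mul f g of smooth_expr D f & smooth_expr D g :
    smooth_expr D (fun x => f x * g x)
| Smooth_inv f of smooth_expr D f & (forall x, D x -> f x != 0) :
    smooth_expr D (fun x => (f x)^-1)
| Smooth_eq f g of smooth_expr D f & (forall x, D x -> f x = g x) :
    smooth_expr D g.

Lemma smooth_expr_regular D f x : open D -> smooth_expr D f -> D x ->
  {for x, continuous f} /\ forall i, derivable f x (delta_mx 0 i).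
Proof.
move=> oD + Dx; elim=> {f}.
- by move=> f /(_ [::] x Dx).
- move=> f _ [cf df]; split=> [|i]; first exact: continuousN.
  exact: (derivableN (df i)).
- move=> f g _ [cf df] _ [cg dg]; split=> [|i]; first exact: continuousD.
  exact: (derivableD (df i) (dg i)).
- move=> f g _ [cf df] _ [cg dg]; split=> [|i]; first exact: continuousM.
  exact: (derivableM (df i) (dg i)).
- move=> f _ [cf df] /(_ x Dx) f0; split=> [|i]; first exact: continuousV.
  exact: (derivableV f0 (df i)).
- move=> f g _ [cf df] fg.
  have fgx : {near x, f =1 g}.
    by apply: filterS (open_nbhs_nbhs (conj oD Dx)) => y; exact: fg.
  split=> [|i]; last exact: (near_eq_derivable fgx).
  exact: near_eq_continuous fgx cf.
Qed.

Lemma smooth_expr_partial D f i : open D -> smooth_expr D f ->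
  smooth_expr D (partial i f).
Proof.
move=> oD; elim=> {f}.
- by move=> f sf; apply: Smooth_base; exact: smooth_on_partial.
- move=> f sf df; apply: Smooth_eq (Smooth_opp df) _ => x Dx.
  have [_ /(_ i) fx] := smooth_expr_regular oD sf Dx.
  by rewrite /partial -deriveN.
- move=> f g sf df sg dg; apply: Smooth_eq (Smooth_add df dg) _ => x Dx.
  have [_ /(_ i) fx] := smooth_expr_regular oD sf Dx.
  have [_ /(_ i) gx] := smooth_expr_regular oD sg Dx.
  by rewrite /partial -deriveD.
- move=> f g sf df sg dg.
  apply: Smooth_eq (Smooth_add (Smooth_mul sf dg) (Smooth_mul sg df)) _ => x Dx.
  have [_ /(_ i) fx] := smooth_expr_regular oD sf Dx.
  have [_ /(_ i) gx] := smooth_expr_regular oD sg Dx.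
  by rewrite /partial [in RHS](deriveM fx gx).
- move=> f sf df f0; have sV := Smooth_inv sf f0.
  apply: Smooth_eq (Smooth_opp (Smooth_mul (Smooth_mul sV sV) df)) _ => x Dx.
  have [_ /(_ i) fx] := smooth_expr_regular oD sf Dx.
  by rewrite /partial [in RHS](deriveV (f0 _ Dx) fx) scaleNr -exprVn expr2.
- move=> f g sf df fg; apply: Smooth_eq df _ => x Dx.
  exact: eq_on_partial fg Dx.
Qed.

Lemma smooth_expr_on D f : open D -> smooth_expr D f -> smooth_on D f.
Proof.
move=> oD sf s x Dx; apply: (@smooth_expr_regular D) => //.
by elim: s => //= i s; exact: smooth_expr_partial.
Qed.

Section Operations.
Variables (D : set 'rV[R]_n) (oD : open D).

Lemma smooth_onD f g : smooth_on D f -> smooth_on D g ->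
  smooth_on D (fun x => f x + g x).
Proof.
move=> sf sg; apply: smooth_expr_on => //.
by apply: Smooth_add; exact: Smooth_base.
Qed.

Lemma smooth_onB f g : smooth_on D f -> smooth_on D g ->
  smooth_on D (fun x => f x - g x).
Proof.
move=> sf sg; apply: smooth_expr_on => //.
by apply: Smooth_add; [|apply: Smooth_opp]; exact: Smooth_base.
Qed.

Lemma smooth_onM f g : smooth_on D f -> smooth_on D g ->
  smooth_on D (fun x => f x * g x).
Proof.
move=> sf sg; apply: smooth_expr_on => //.
by apply: Smooth_mul; exact: Smooth_base.
Qed.

Lemma smooth_on_div f g : smooth_on D f -> smooth_on D g ->
  (forall x, D x -> g x != 0) -> smooth_on D (fun x => f x / g x).
Proof.
move=> sf sg g0; apply: smooth_expr_on => //.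
by apply: Smooth_mul; [|apply: Smooth_inv => //]; exact: Smooth_base.
Qed.

Lemma smooth_on_eq f g : smooth_on D f -> (forall x, D x -> f x = g x) ->
  smooth_on D g.
Proof.
by move=> sf fg; apply: smooth_expr_on => //; apply: Smooth_eq fg;
  exact: Smooth_base.
Qed.

Lemma partialD f g i x : smooth_on D f -> smooth_on D g -> D x ->
  partial i (fun y => f y + g y) x = partial i f x + partial i g x.
Proof.
move=> sf sg Dx; have df := smooth_on_is_derive i sf Dx.
have dg := smooth_on_is_derive i sg Dx.
exact: (@derive_val _ _ _ _ _ _ _ (is_deriveD df dg)).
Qed.

Lemma partialB f g i x : smooth_on D f -> smooth_on D g -> D x ->
  partial i (fun y => f y - g y) x = partial i f x - partial i g x.
Proof.
move=> sf sg Dx; have df := smooth_on_is_derive i sf Dx.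
have dg := smooth_on_is_derive i sg Dx.
exact: (@derive_val _ _ _ _ _ _ _ (is_deriveB df dg)).
Qed.

Lemma partialM f g i x : smooth_on D f -> smooth_on D g -> D x ->
  partial i (fun y => f y * g y) x = partial i f x * g x + f x * partial i g x.
Proof.
move=> sf sg Dx; have df := smooth_on_is_derive i sf Dx.
have dg := smooth_on_is_derive i sg Dx.
rewrite addrC [partial i f x * _]mulrC.
exact: (@derive_val _ _ _ _ _ _ _ (is_deriveM df dg)).
Qed.

Lemma partial_div f g i x : smooth_on D f -> smooth_on D g ->
  (forall y, D y -> g y != 0) -> D x ->
  partial i (fun y => f y / g y) x =
    (partial i f x * g x - f x * partial i g x) / g x ^+ 2.
Proof.
move=> sf sg g0 Dx; have sq := smooth_on_div sf sg g0.
have gx := g0 _ Dx.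
have : partial i f x = partial i (fun y => f y / g y * g y) x.
  by apply: (eq_on_partial i oD) => // y Dy; rewrite divfK// g0.
rewrite partialM// => ->; by field.
Qed.

End Operations.
End SmoothFunctions.

(** * Velocities of commuting flows *)

Section Velocities.
Context {R : realType} {n : nat} {D : set 'rV[R]_n}.
Implicit Types (v lam mu : 'I_n -> 'rV[R]_n -> R) (i j alpha : 'I_n).

Lemma partial_velocity v i j x : distinct_velocities D v -> i != j -> D x ->
  partial j (v i) x = coef_a v i j x * (v j x - v i x).
Proof.
move=> dv ij Dx; rewrite /coef_a divfK// subr_eq0.
by apply: dv => //; rewrite eq_sym.
Qed.

Lemma partial_commuting_flow lam mu i j x : distinct_velocities D mu ->
  commuting_flow D lam mu -> i != j -> D x ->
  partial j (mu i) x = coef_a lam i j x * (mu j x - mu i x).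
Proof. by move=> dmu cm ij Dx; rewrite (partial_velocity dmu ij Dx) cm. Qed.

Lemma smooth_coef_a v i j : open D -> smooth_velocities D v ->
  distinct_velocities D v -> i != j -> smooth_on D (coef_a v i j).
Proof.
move=> oD sv dv ij; apply: smooth_on_div => //.
- exact/smooth_on_partial/sv.
- by apply: smooth_onB => //; exact: sv.
- by move=> x Dx; rewrite subr_eq0; apply: dv => //; rewrite eq_sym.
Qed.

(** Obtained by differentiating [partial_commuting_flow] in the direction [i]
    and exchanging the two derivatives. *)
Lemma partial2_velocity lam mu i j x : open D ->
  smooth_velocities D lam -> distinct_velocities D lam ->
  smooth_velocities D mu -> distinct_velocities D mu ->
  commuting_flow D lam mu -> i != j -> D x ->
  partial j (partial i (mu i)) x =
    partial i (coef_a lam i j) x * (mu j x - mu i x)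
    + coef_a lam i j x *
      (coef_a lam j i x * (mu i x - mu j x) - partial i (mu i) x).
Proof.
move=> oD slam dlam smu dmu cm ij Dx.
have ji : j != i by rewrite eq_sym.
rewrite (partial_comm _ _ oD (smu i) Dx).
have E y : D y -> partial j (mu i) y = coef_a lam i j y * (mu j y - mu i y).
  by move=> Dy; rewrite (partial_commuting_flow dmu cm ij Dy).
rewrite (eq_on_partial i oD E Dx).
have sB := smooth_onB oD (smu j) (smu i).
rewrite (partialM _ (smooth_coef_a oD slam dlam ij) sB Dx).
rewrite (partialB _ (smu j) (smu i) Dx).
by rewrite (partial_commuting_flow dmu cm ji Dx).
Qed.

End Velocities.

(** * The transformed system *)

Lemma new_velocity_alpha {R : realType} {n : nat}
    (lam mu : 'I_n -> 'rV[R]_n -> R) (alpha : 'I_n) x :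
  new_velocity lam mu alpha alpha x =
  (lam alpha x * partial alpha (mu alpha) x
   - mu alpha x * partial alpha (lam alpha) x) / partial alpha (mu alpha) x.
Proof. by rewrite /new_velocity eqxx. Qed.

Lemma new_velocity_neq {R : realType} {n : nat}
    (lam mu : 'I_n -> 'rV[R]_n -> R) (alpha i : 'I_n) x : i != alpha ->
  new_velocity lam mu alpha i x =
  (lam i x * mu alpha x - lam alpha x * mu i x) / (mu alpha x - mu i x).
Proof. by rewrite /new_velocity => /negbTE ->. Qed.

(** At a point, with [l], [m], [li], [mi] the velocities of [lam] and [mu] of
    indices [alpha] and [i], [a] and [b] the coefficients of indices
    [alpha i] and [i alpha], and [l1], [m1], [a1], [V1] resp. [Wi] the
    derivatives in the direction [alpha] resp. [i], the last two premises are the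
    equalities of the mixed derivatives of [U] and of [F]. *)
Lemma compatibility_elimination {K : fieldType}
    (l m li mi l1 m1 a b a1 W Wi V V1 : K) :
  (l - li) * m1 - l1 * (m - mi) != 0 ->
  Wi * m1 + W * (a1 * (mi - m) + a * (b * (m - mi) - m1)) =
    (m1 - b * (m - mi)) * V + (m - mi) * V1 ->
  Wi * (l * m1 - m * l1)
    + W * ((a * (li - l) * m1 + l * (a1 * (mi - m) + a * (b * (m - mi) - m1)))
           - (a * (mi - m) * l1 + m * (a1 * (li - l) + a * (b * (l - li) - l1)))) =
    (b * (l - li) * m + li * m1 - (l1 * mi + l * (b * (m - mi)))) * V
    + (li * m - l * mi) * V1 ->
  m * Wi + W * a * (mi - 2 * m) = mi * V.
Proof.
move=> k0 e1 e2; apply: (mulfI k0).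
apply/eqP; rewrite -subr_eq0; apply/eqP.
have lincomb (u v s t p q : K) : u = v -> s = t -> p * (s - t) - q * (u - v) = 0.
  by move=> -> ->; rewrite !subrr !mulr0 subrr.
(* This combination of the last two premises cancels V1. *)
rewrite -[RHS](lincomb _ _ _ _ (m - mi) (li * m - l * mi) e1 e2).
by ring.
Qed.

Section Transform.
Context {R : realType} {n : nat} (D : set 'rV[R]_n).
Context (lam mu : 'I_n -> 'rV[R]_n -> R) (alpha : 'I_n).
Context (oD : open D)
  (slam : smooth_velocities D lam) (dlam : distinct_velocities D lam)
  (smu : smooth_velocities D mu) (dmu : distinct_velocities D mu)
  (cm : commuting_flow D lam mu)
  (mu0 : forall x, D x -> mu alpha x != 0)
  (dmu0 : forall x, D x -> partial alpha (mu alpha) x != 0).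
Implicit Types (u f q U F : 'rV[R]_n -> R).

Local Notation Lam := (new_velocity lam mu alpha).

Lemma conservation_law_Lstar u f q :
  conservation_law D lam u f -> flux_of D mu u q ->
  conservation_law D Lam (Lstar_density mu alpha q u)
    (Lstar_flux lam mu alpha q f).
Proof.
move=> [su sf uf] [sq uq].
have sl := slam alpha; have sm := smu alpha.
have slq := smooth_onM oD sl sq.
have sqm := smooth_on_div oD sq sm mu0.
have slqm := smooth_on_div oD slq sm mu0.
split=> [||i x Dx]; [exact: smooth_onB|exact: smooth_onB|].
rewrite /Lstar_density /Lstar_flux.
rewrite (partialB _ su sqm Dx) (partialB _ sf slqm Dx).
rewrite (partial_div oD _ sq sm mu0 Dx) (partial_div oD _ slq sm mu0 Dx).
rewrite (partialM _ sl sq Dx) (uf _ _ Dx) (uq _ _ Dx).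
have m0 := mu0 Dx; have d0 := dmu0 Dx.
have [->|ia] := eqVneq i alpha.
  by rewrite new_velocity_alpha; field; rewrite m0 d0.
have ai : alpha != i by rewrite eq_sym.
rewrite new_velocity_neq// (partial_commuting_flow dmu cm ai Dx).
rewrite (partial_velocity dlam ai Dx).
have mi0 : mu alpha x - mu i x != 0 by rewrite subr_eq0; exact: dmu.
by field; rewrite m0 mi0.
Qed.

Context (dLam : distinct_velocities D Lam).

(** Up to a nonzero factor, the left-hand side is the difference of the new
    velocities of indices [alpha] and [i]. *)
Lemma new_velocity_gap_neq0 i x : i != alpha -> D x ->
  (lam alpha x - lam i x) * partial alpha (mu alpha) x
  - partial alpha (lam alpha) x * (mu alpha x - mu i x) != 0.
Proof.
move=> ia Dx; have ai : alpha != i by rewrite eq_sym.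
have m0 := mu0 Dx; have d0 := dmu0 Dx.
have mi0 : mu alpha x - mu i x != 0 by rewrite subr_eq0; exact: dmu.
apply: contraNneq (dLam ai Dx) => k0; rewrite -subr_eq0.
rewrite new_velocity_alpha new_velocity_neq//.
set k := (X in X = 0) in k0.
rewrite [X in X == 0](_ : _ =
  k * mu alpha x / (partial alpha (mu alpha) x * (mu alpha x - mu i x))).
  by rewrite k0 !mul0r.
by rewrite /k; field; rewrite d0 mi0.
Qed.

(** The only possible flux [q] of a density [u] such that [U] is the transform
    of [u]. *)
Definition recovered_flux U : 'rV[R]_n -> R :=
  fun x => partial alpha U x / partial alpha (mu alpha) x * mu alpha x ^+ 2.

Lemma smooth_recovered_flux U : smooth_on D U -> smooth_on D (recovered_flux U).
Proof.
move=> sU; apply: (smooth_onM oD).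
  exact: (smooth_on_div oD (smooth_on_partial alpha sU)
    (smooth_on_partial alpha (smu alpha)) dmu0).
exact: (smooth_onM oD (smu alpha) (smu alpha)).
Qed.

(** The second-order relation satisfied by the conservation laws of the new
    system. *)
Lemma new_law_compatibility U F i x : i != alpha -> D x ->
  conservation_law D Lam U F ->
  let W := fun y => partial alpha U y / partial alpha (mu alpha) y in
  let V := fun y => partial i U y / (mu alpha y - mu i y) in
  mu alpha x * partial i W x
    + W x * coef_a lam alpha i x * (mu i x - 2 * mu alpha x) = mu i x * V x.
Proof.
move=> ia Dx [sU sF UF] W V; have ai : alpha != i by rewrite eq_sym.
have sl := slam alpha; have sm := smu alpha.
have sl1 := smooth_on_partial alpha sl; have sm1 := smooth_on_partial alpha sm.
have smi := smooth_onB oD sm (smu i).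
have mi0 y : D y -> mu alpha y - mu i y != 0.
  by move=> Dy; rewrite subr_eq0; exact: dmu.
have sW : smooth_on D W := smooth_on_div oD (smooth_on_partial alpha sU) sm1 dmu0.
have sV : smooth_on D V := smooth_on_div oD (smooth_on_partial i sU) smi mi0.
have Ua y : D y -> partial alpha U y = W y * partial alpha (mu alpha) y.
  by move=> Dy; rewrite /W divfK// dmu0.
have Ui y : D y -> partial i U y = (mu alpha y - mu i y) * V y.
  by move=> Dy; rewrite /V mulrC divfK// mi0.
have Fa y : D y -> partial alpha F y = W y *
    (lam alpha y * partial alpha (mu alpha) y
     - mu alpha y * partial alpha (lam alpha) y).
  move=> Dy; rewrite (UF _ _ Dy) new_velocity_alpha /W.
  by rewrite mulrAC -mulrA mulrC.
have Fi y : D y -> partial i F y =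
    (lam i y * mu alpha y - lam alpha y * mu i y) * V y.
  move=> Dy; rewrite (UF _ _ Dy) new_velocity_neq// /V.
  by rewrite mulrAC mulrA.
have slm1 := smooth_onM oD sl sm1; have sml1 := smooth_onM oD sm sl1.
have slim := smooth_onM oD (slam i) sm; have slmi := smooth_onM oD sl (smu i).
have CU := partial_comm alpha i oD sU Dx.
rewrite (eq_on_partial alpha oD Ui Dx) (eq_on_partial i oD Ua Dx) in CU.
rewrite (partialM _ smi sV Dx) (partialB _ sm (smu i) Dx) in CU.
rewrite (partialM _ sW sm1 Dx) in CU.
have CF := partial_comm alpha i oD sF Dx.
rewrite (eq_on_partial alpha oD Fi Dx) (eq_on_partial i oD Fa Dx) in CF.
rewrite (partialM _ (smooth_onB oD slim slmi) sV Dx) in CF.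
rewrite (partialB _ slim slmi Dx) in CF.
rewrite (partialM _ (slam i) sm Dx) (partialM _ sl (smu i) Dx) in CF.
rewrite (partialM _ sW (smooth_onB oD slm1 sml1) Dx) in CF.
rewrite (partialB _ slm1 sml1 Dx) in CF.
rewrite (partialM _ sl sm1 Dx) (partialM _ sm sl1 Dx) in CF.
rewrite (partial2_velocity oD slam dlam smu dmu cm ai Dx) in CU CF.
have cl : commuting_flow D lam lam by [].
rewrite (partial2_velocity oD slam dlam slam dlam cl ai Dx) in CF.
rewrite (partial_commuting_flow dmu cm ia Dx) in CU CF.
rewrite (partial_velocity dlam ia Dx) (partial_velocity dlam ai Dx) in CF.
rewrite (partial_commuting_flow dmu cm ai Dx) in CF.
exact: (compatibility_elimination (new_velocity_gap_neq0 ia Dx)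
  (esym CU) (esym CF)).
Qed.

Lemma recovered_flux_of U F :
  conservation_law D Lam U F ->
  flux_of D mu (fun x => U x + recovered_flux U x / mu alpha x)
    (recovered_flux U).
Proof.
move=> UF; have [sU _ _] := UF.
split=> [|i x Dx]; first exact: smooth_recovered_flux.
have sm := smu alpha; have sq := smooth_recovered_flux sU.
have sqm := smooth_on_div oD sq sm mu0.
rewrite (partialD _ sU sqm Dx) (partial_div oD _ sq sm mu0 Dx).
have m0 := mu0 Dx; have d0 := dmu0 Dx.
have [->|ia] := eqVneq i alpha.
  by rewrite /recovered_flux; field; rewrite m0 d0.
have ai : alpha != i by rewrite eq_sym.
have mi0 : mu alpha x - mu i x != 0 by rewrite subr_eq0; exact: dmu.
have sW := smooth_on_div oD (smooth_on_partial alpha sU)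
  (smooth_on_partial alpha sm) dmu0.
have E := new_law_compatibility ia Dx UF; cbv zeta in E.
rewrite (partialM _ sW (smooth_onM oD sm sm) Dx) (partialM _ sm sm Dx).
rewrite (partial_commuting_flow dmu cm ai Dx) /recovered_flux.
have {}E : partial i (fun y => partial alpha U y / partial alpha (mu alpha) y) x =
  (mu i x * (partial i U x / (mu alpha x - mu i x)) -
  partial alpha U x / partial alpha (mu alpha) x * coef_a lam alpha i x
    * (mu i x - 2 * mu alpha x)) / mu alpha x.
  by rewrite -E addrK mulrAC divff// mul1r.
by rewrite E; field; rewrite m0 d0 mi0.
Qed.

Lemma recovered_conservation_law U F :
  conservation_law D Lam U F ->
  conservation_law D lam (fun x => U x + recovered_flux U x / mu alpha x)
    (fun x => F x + lam alpha x * recovered_flux U x / mu alpha x).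
Proof.
move=> UF; have [sU sF dF] := UF; have [sq dq] := recovered_flux_of UF.
have sl := slam alpha; have sm := smu alpha.
have slq := smooth_onM oD sl sq.
have sqm := smooth_on_div oD sq sm mu0.
have slqm := smooth_on_div oD slq sm mu0.
split=> [||i x Dx]; [exact: smooth_onD|exact: smooth_onD|].
have := dq i x Dx.
rewrite (partialD _ sU sqm Dx) (partialD _ sF slqm Dx).
rewrite (partial_div oD _ sq sm mu0 Dx) (partial_div oD _ slq sm mu0 Dx).
rewrite (partialM _ sl sq Dx) (dF _ _ Dx).
have m0 := mu0 Dx; have d0 := dmu0 Dx.
have [->|ia] := eqVneq i alpha.
  move=> _; rewrite new_velocity_alpha /recovered_flux.
  by field; rewrite m0 d0.
have ai : alpha != i by rewrite eq_sym.
have mi0 : mu alpha x - mu i x != 0 by rewrite subr_eq0; exact: dmu.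
rewrite (partial_commuting_flow dmu cm ai Dx) (partial_velocity dlam ai Dx).
rewrite new_velocity_neq//.
move: (partial i (recovered_flux U) x) => q1 E.
have -> : q1 = mu i x * (mu alpha x * partial i U x / (mu alpha x - mu i x)
    + recovered_flux U x * coef_a lam alpha i x / mu alpha x).
  apply: (mulIf mi0); rewrite mulrBr {1}E.
  by field; rewrite m0 mi0.
by field; rewrite m0 mi0.
Qed.

End Transform.

Unset Implicit Arguments.
Set Strict Implicit.

Theorem theorem3 (R : realType) (n : nat) (D : set 'rV[R]_n)
    (lam mu : 'I_n -> 'rV[R]_n -> R) (alpha : 'I_n)
    (hD : simply_connected_domain D)
    (lam_smooth : smooth_velocities D lam)
    (lam_distinct : distinct_velocities D lam)
    (lam_semihamiltonian : semihamiltonian D lam)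
    (mu_smooth : smooth_velocities D mu)
    (mu_distinct : distinct_velocities D mu)
    (mu_commuting : commuting_flow D lam mu)
    (mu_alpha_neq0 : forall x, D x -> mu alpha x != 0)
    (dmu_alpha_neq0 : forall x, D x -> partial alpha (mu alpha) x != 0)
    (Lam_distinct : distinct_velocities D (new_velocity lam mu alpha)) :
  forall U F : 'rV[R]_n -> R,
    conservation_law D (new_velocity lam mu alpha) U F <->
    exists u f q : 'rV[R]_n -> R,
      [/\ conservation_law D lam u f,
          flux_of D mu u q,
          forall x, D x -> U x = Lstar_density mu alpha q u x &
          forall x, D x -> F x = Lstar_flux lam mu alpha q f x].
Proof.
have [_ oD _] := hD; move=> U F; split=> [UF|[u [f [q [uf uq Uu Ff]]]]].
  exists (fun x => U x + recovered_flux mu alpha U x / mu alpha x),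
    (fun x => F x + lam alpha x * recovered_flux mu alpha U x / mu alpha x),
    (recovered_flux mu alpha U).
  split.
  - exact: recovered_conservation_law UF.
  - exact: recovered_flux_of UF.
  - by move=> x _; rewrite /Lstar_density addrK.
  - by move=> x _; rewrite /Lstar_flux addrK.
have [sU sF dF] : conservation_law D (new_velocity lam mu alpha)
    (Lstar_density mu alpha q u) (Lstar_flux lam mu alpha q f).
  exact: conservation_law_Lstar.
split=> [||i x Dx].
- by apply: smooth_on_eq sU _ => // x Dx; rewrite Uu.
- by apply: smooth_on_eq sF _ => // x Dx; rewrite Ff.
- by rewrite (eq_on_partial i oD Uu Dx) (eq_on_partial i oD Ff Dx) dF.
Qed.
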